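(* For every $n\ge 1$, $|\mathcal{RS}_n(213)|=M_n$, where $M_n$ is the $n$th Motzkin number.
   Context: For $\sigma\in\mathfrak{S}_n$, a double descent is an index $i$ with $\sigma_i>\sigma_{i+1}>\sigma_{i+2}$. The permutation $\sigma$ is simsun if for every $k$, the subword of $\sigma$ consisting of the letters in $\{1,\dots,k\}$ (in the order they appear in $\sigma$) has no double descent. For $\omega\in\mathfrak{S}_t$, $\sigma$ contains an $\omega$-pattern if there are indices $i_1<\cdots<i_t$ with $\sigma_{i_j}<\sigma_{i_k}$ iff $\omega_j<\omega_k$; otherwise $\sigma$ is $\omega$-avoiding. $\mathcal{RS}_n(\omega)$ is the set of $\omega$-avoiding simsun permutations in $\mathfrak{S}_n$. The Motzkin number $M_n$ is the number of lattice paths from $(0,0)$ to $(n,0)$ with steps $(1,1)$, $(1,-1)$, $(1,0)$ never going below the $x$-axis. *)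

(* Defs.v *)
From HB Require Import structures.
From mathcomp Require Import all_boot all_order all_fingroup all_algebra.

Set Implicit Arguments.
Unset Strict Implicit.
Unset Printing Implicit Defensive.

Import Order.TTheory GRing.Theory Num.Theory.

(* Permutations of {1, ..., n} are represented by 'S_n, the permutations of
   {0, ..., n-1}: positions and letters are both shifted down by one. *)

Definition word n (s : 'S_n) : seq nat := [seq val (s i) | i <- enum 'I_n].

Definition double_descent (w : seq nat) (i : nat) : bool :=
  [&& i.+2 < size w, nth 0 w i.+1 < nth 0 w i & nth 0 w i.+2 < nth 0 w i.+1].

Definition has_double_descent (w : seq nat) : bool :=
  [exists i : 'I_(size w), double_descent w i].

(* The letters {1, ..., k} are, after the shift, the x with x < k; bounding k
   by n loses nothing, since for k >= n the subword is the whole word. *)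
Definition simsun n (s : 'S_n) : bool :=
  [forall k : 'I_n.+1, ~~ has_double_descent [seq x <- word s | x < k]].

Definition contains_pattern t n (omega : 'S_t) (s : 'S_n) : bool :=
  [exists f : {ffun 'I_t -> 'I_n},
    [forall j : 'I_t, forall k : 'I_t, (j < k) ==> (f j < f k)] &&
    [forall j : 'I_t, forall k : 'I_t, (s (f j) < s (f k)) == (omega j < omega k)]].

Definition avoids_pattern t n (omega : 'S_t) (s : 'S_n) : bool :=
  ~~ contains_pattern omega s.

Definition RS t n (omega : 'S_t) : {set 'S_n} :=
  [set s : 'S_n | simsun s & avoids_pattern omega s].

(* 213 exchanges the first two letters and fixes the third; see word_perm213. *)
Definition perm213 : 'S_3 :=
  tperm (Ordinal (isT : 0 < 3)) (Ordinal (isT : 1 < 3)).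

Lemma word_perm213 : word perm213 = [:: 1; 0; 2].
Proof.
apply: (@eq_from_nth _ 0) => [|i]; first by rewrite size_map size_enum_ord.
rewrite size_map size_enum_ord => lti.
rewrite (nth_map (Ordinal lti)) ?size_enum_ord // /perm213 permE /=.
have -> : nth (Ordinal lti) (enum 'I_3) i = Ordinal lti.
  by apply: val_inj; rewrite /= nth_enum_ord.
by case: i lti => [|[|[|]]].
Qed.

Inductive motzkin_step := Up | Down | Level.

Definition option_bool_of_step (a : motzkin_step) : option bool :=
  match a with Up => Some true | Down => Some false | Level => None end.

Definition step_of_option_bool (b : option bool) : motzkin_step :=
  match b with Some true => Up | Some false => Down | None => Level end.

Lemma option_bool_of_stepK : cancel option_bool_of_step step_of_option_bool.
Proof. by case. Qed.

HB.instance Definition _ := Countable.copy motzkin_step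
  (can_type option_bool_of_stepK).
HB.instance Definition _ : isFinite motzkin_step :=
  CanIsFinite option_bool_of_stepK.

Definition step_vec (a : motzkin_step) : int * int :=
  match a with
  | Up => (1, 1)%R
  | Down => (1, -1)%R
  | Level => (1, 0)%R
  end.

(* The lattice point reached from (0,0) by the steps p. *)
Definition endpoint (p : seq motzkin_step) : int * int :=
  (\sum_(a <- p) step_vec a)%R.

Definition motzkin_path n (p : seq motzkin_step) : bool :=
  (endpoint p == (n%:Z, 0)%R) &&
  [forall k : 'I_(size p).+1, (0 <= (endpoint (take k p)).2)%R].

(* Every step advances the abscissa by 1, so a path from (0,0) to (n,0) has
   exactly n steps; hence the tuples of length n. *)
Definition motzkin (n : nat) : nat :=
  #|[set p : n.-tuple motzkin_step | motzkin_path n p]|.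

(* Main.v *)
(* Write a 213-avoiding word as u ++ b :: v with b its least letter; then all
   of u lies above all of v. It is simsun iff v is simsun and u is empty or can
   be followed by a smaller letter without creating a double descent in any
   restriction. Words u of this second kind split in the same way, except that
   v = [::] forces u = [::]. With S and Q the generating functions of the simsun
   words and of the nonempty words of the second kind,
   S = 1 + x S + x Q S and Q = x + x Q + x Q^2, so that Q = x M and S = M for
   the Motzkin series M = 1 + x M + x^2 M^2. Both the words and the Motzkin
   paths are thus read off unary-binary trees. *)

Require Import Defs.
From mathcomp Require Import all_boot all_fingroup all_algebra zify.

Set Implicit Arguments.
Unset Strict Implicit.
Unset Printing Implicit Defensive.

(** Choosing a partner for each element gives a map that is injective on [A]. A relation suffices,
    so no tree has to be computed from a word or a path. *)
Lemma leq_card_rel (S T : finType) (A : {set S}) (B : {set T})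
    (r : S -> T -> Prop) :
    (forall a, a \in A -> exists2 b, b \in B & r a b) ->
    (forall a a' b, r a b -> r a' b -> a = a') ->
  #|A| <= #|B|.
Proof.
move=> rA r_inj; have [->|[a0 /rA[b0 _ _]]] := set_0Vmem A; first by rewrite cards0.
have /fin_all_exists[f fP] : forall a, exists b, a \in A -> b \in B /\ r a b.
  move=> a; case: (boolP (a \in A)) => [/rA[b bB rab]|_]; last by exists b0.
  by exists b.
rewrite -(@card_in_imset _ _ f).
  by apply/subset_leq_card/subsetP => _ /imsetP[a /fP[fB _] ->].
move=> a a' /fP[_ ra] /fP[_ ra'] eq_f.
by apply: (r_inj _ _ (f a)) => //; rewrite eq_f.
Qed.

(** * Motzkin trees and paths *)

Inductive mtree := Leaf | Unary of mtree | Binary of mtree & mtree.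

(** The weights 0, 1, 2 match the terms 1, x M, x^2 M^2 of the Motzkin series. *)
Fixpoint tsize t :=
  match t with
  | Leaf => 0
  | Unary t => (tsize t).+1
  | Binary t1 t2 => (tsize t1 + tsize t2).+2
  end.

Fixpoint tree_path t :=
  match t with
  | Leaf => [::]
  | Unary t => Level :: tree_path t
  | Binary t1 t2 => Up :: tree_path t1 ++ Down :: tree_path t2
  end.

(** Here [h] is the current height; with heights in [nat], staying on or above the axis is checked
    only at [Down]. *)
Fixpoint path_from h p :=
  match p with
  | [::] => h == 0
  | Up :: p => path_from h.+1 p
  | Level :: p => path_from h p
  | Down :: p => (0 < h) && path_from h.-1 p
  end.

Lemma size_tree_path t : size (tree_path t) = tsize t.
Proof.
elim: t => //= [t -> //|t1 IH1 t2 IH2].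
by rewrite size_cat /= IH1 IH2 addnS.
Qed.

Lemma path_from_cat h t r : path_from h (tree_path t ++ r) = path_from h r.
Proof.
elim: t h r => //= t1 IH1 t2 IH2 h r.
by rewrite -catA IH1 /= IH2.
Qed.

(** No [tree_path] starts with [Down], so such a remainder shows where the tree ends. Remainders
    arise from the first subtree of a [Binary]. *)
Lemma tree_path_cat_inj t t' r r' :
    ohead r \in [:: None; Some Down] -> ohead r' \in [:: None; Some Down] ->
  tree_path t ++ r = tree_path t' ++ r' -> t = t' /\ r = r'.
Proof.
elim: t t' r r' => [|t IH|t1 IH1 t2 IH2] [|t'|t1' t2'] r r' //=.
- by move=> rP _ def_r; rewrite def_r in rP.
- by move=> rP _ def_r; rewrite def_r in rP.
- by move=> _ rP def_r; rewrite -def_r in rP.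
- by move=> rP rP' [/IH[] // -> ->].
- by move=> _ rP def_r; rewrite -def_r in rP.
- move=> rP rP' []; rewrite -!catA => /IH1[] // -> /= [/IH2[] // -> ->].
  by [].
Qed.

Lemma tree_path_inj : injective tree_path.
Proof.
move=> t t' eq_t; have [] // := @tree_path_cat_inj t t' [::] [::] => //.
by rewrite eq_t.
Qed.

(** The remainder starts with the first step going below height [h], if any. Induction is on the
    length because the second subtree of a [Binary] is parsed from a remainder. *)
Lemma path_from_parse h p : path_from h p ->
  exists t r, p = tree_path t ++ r /\
    (r = [::] /\ h = 0 \/ exists2 r', r = Down :: r' & 0 < h /\ path_from h.-1 r').
Proof.
have [m] := ubnP (size p); elim: m => // m IH in h p *.
case: p => [_ /eqP->|[] p /= ltm].
- by exists Leaf, [::]; split=> //; left.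
(* From height [h.+1] the remainder cannot be empty: it starts with the [Down] matching this
   [Up]. *)
- case/IH=> // t1 [r [def_p [[] //|[r' def_r [_ /= hr']]]]].
  have ltr' : size r' < m.
    by move: ltm; rewrite def_p def_r size_cat /=; lia.
  have [t2 [r2 [def_r' r2P]]] := IH h r' ltr' hr'.
  exists (Binary t1 t2), r2; split=> //=.
  by rewrite def_p def_r def_r' -catA.
- by case/andP=> h_gt0 hp; exists Leaf, (Down :: p); split=> //; right; exists p.
- case/IH=> // t [r [-> rP]]; by exists (Unary t), r.
Qed.

Lemma path_from0P p : path_from 0 p -> exists t, p = tree_path t.
Proof.
case/path_from_parse=> t [r [-> [[-> _]|[r' _ [] //]]]].
by exists t; rewrite cats0.
Qed.

(** * Lattice paths described by heights *)

Section Endpoint.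
Import GRing.Theory Num.Theory.
Local Open Scope ring_scope.

Lemma endpoint_cons a p : endpoint (a :: p) = step_vec a + endpoint p.
Proof. by rewrite /endpoint big_cons. Qed.

Lemma endpoint1 p : (endpoint p).1 = (size p)%:Z.
Proof.
elim: p => [|a p IH]; first by rewrite /endpoint big_nil.
by rewrite endpoint_cons /= IH; case: a => /=; lia.
Qed.

Lemma path_fromP (h : nat) p :
  reflect (h%:Z + (endpoint p).2 = 0 /\
           forall k, 0 <= h%:Z + (endpoint (take k p)).2)
          (path_from h p).
Proof.
elim: p h => [|a p IH] h.
  apply: (iffP eqP); rewrite /endpoint big_nil /=; last by case; lia.
  by move=> ->; split=> // k; rewrite big_nil.
have e0 : (endpoint [::]).2 = 0 by rewrite /endpoint big_nil.
(* The first step moves the starting height from [h] to [h'], and prefixes of length [k.+1] become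
   prefixes of length [k]. *)
have split_k (h' : nat) : h%:Z + (step_vec a).2 = h'%:Z ->
    (h'%:Z + (endpoint p).2 = 0 /\
       forall k, 0 <= h'%:Z + (endpoint (take k p)).2) <->
    (h%:Z + (endpoint (a :: p)).2 = 0 /\
       forall k, 0 <= h%:Z + (endpoint (take k (a :: p))).2).
  move=> def_h'; rewrite endpoint_cons /= addrA def_h'.
  split=> -[-> ge0]; split=> // k; last first.
    by have := ge0 k.+1; rewrite /= endpoint_cons /= addrA def_h'.
  case: k => [|k] /=; first by rewrite e0; lia.
  by rewrite endpoint_cons /= addrA def_h'.
case: a split_k => /= split_k.
- by apply: (iffP (IH _)) => /split_k; apply; lia.
- apply: (iffP andP) => [[h_gt0 /IH]|hP].
    by move/split_k; apply; lia.
  (* The prefix of length 1 ends at height [h - 1]. *)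
  have h_gt0 : (0 < h)%N.
    have [_ /(_ 1%N)] := hP.
    by rewrite /= take0 endpoint_cons /= e0; lia.
  split=> //; apply/IH/split_k => //; lia.
- by apply: (iffP (IH _)) => /split_k; apply; lia.
Qed.

Lemma motzkin_pathE n p : size p = n -> motzkin_path n p = path_from 0%N p.
Proof.
move=> szp; apply/andP/path_fromP => [[/eqP ep /forallP ge0]|[ep ge0]].
  split=> [|k]; first by rewrite ep.
  have [lek|ltk] := leqP k (size p).
    by have := ge0 (Ordinal (lek : (k < (size p).+1)%N)); rewrite add0r.
  by rewrite take_oversize ?ep //; lia.
split; last by apply/forallP=> k; have := ge0 k; rewrite add0r.
by rewrite [endpoint p]surjective_pairing endpoint1 szp -[X in (_, X)]add0r ep.
Qed.

End Endpoint.

(** * Double descents *)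

Lemma has_double_descentP w :
  reflect (exists i, double_descent w i) (has_double_descent w).
Proof.
apply: (iffP existsP) => [[i wi]|[i wi]]; first by exists i.
have lti : i < size w by case/and3P: wi; lia.
by exists (Ordinal lti).
Qed.

Lemma has_double_descent_cons x w :
  has_double_descent (x :: w) = double_descent (x :: w) 0 || has_double_descent w.
Proof.
apply/has_double_descentP/orP => [[[|i] wi]|[w0|/has_double_descentP[i wi]]].
- by left.
- by right; apply/has_double_descentP; exists i.
- by exists 0.
- by exists i.+1.
Qed.

Lemma has_double_descent_short w : size w <= 2 -> has_double_descent w = false.
Proof.
by move=> sz; apply/has_double_descentP => -[i /and3P[]]; lia.
Qed.

Lemma has_double_descent_catr u v :
  has_double_descent v -> has_double_descent (u ++ v).
Proof.
by elim: u => //= x u IH /IH; rewrite has_double_descent_cons orbC => ->.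
Qed.

Lemma has_double_descent_catl u v :
  has_double_descent u -> has_double_descent (u ++ v).
Proof.
elim: u => [|x u IH]; first by rewrite has_double_descent_short.
rewrite /= !has_double_descent_cons => /orP[|/IH->]; last by rewrite orbT.
by case: u {IH} => [|y [|z u]] // /and3P[_ /= yx zy]; rewrite /double_descent /= yx zy.
Qed.

(** No descent starts at [b]; the default of [head] admits an empty [v]. *)
Lemma has_double_descent_cons_le b v :
  b <= head b v -> has_double_descent (b :: v) = has_double_descent v.
Proof.
rewrite has_double_descent_cons; case: v => [|y [|z v]] //= leby.
by rewrite /double_descent /= (ltnNge y b) leby.
Qed.

(** A double descent meeting both [u] and [v] would have [b] in its middle, but no descent starts at
    [b]. *)
Lemma has_double_descent_cat u b v : b <= head b v ->
  has_double_descent (u ++ b :: v) =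
    has_double_descent (rcons u b) || has_double_descent (b :: v).
Proof.
move=> lebv; elim: u => [|x u IH] //=.
  by rewrite (@has_double_descent_short [:: b]).
rewrite !(has_double_descent_cons x) IH orbA; congr (_ || _ || _).
case: u {IH} => [|y [|z u]] //=; rewrite /double_descent /=.
by case: v lebv => [|y v] //= leby; rewrite (ltnNge y b) leby !andbF.
Qed.

(** Only comparisons with the last letter could differ, and they agree. After [u], the least letter
    and the marker 0 are thus interchangeable. *)
Lemma has_double_descent_rcons_low u b c :
    all (fun x => b < x) u -> all (fun x => c < x) u ->
  has_double_descent (rcons u b) = has_double_descent (rcons u c).
Proof.
elim: u => [|x u IH] /=; first by rewrite !has_double_descent_short.
case/andP=> bx bu /andP[cx cu]; rewrite !has_double_descent_cons IH //.
congr (_ || _); case: u bu cu {IH} => [|y [|z u]] //=.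
by rewrite /double_descent /= !andbT => -> ->.
Qed.

(** The last letter of [u] followed by [b] and [c] is the double descent. *)
Lemma has_double_descent_low2 u b c : u != [::] ->
  all (fun x => b < x) u -> c < b -> has_double_descent (u ++ [:: b; c]).
Proof.
elim: u => [|x u IH] //= _ /andP[bx bu] cb; rewrite has_double_descent_cons.
have [->|u0] := eqVneq u [::]; first by rewrite /double_descent /= bx cb.
by rewrite IH // orbT.
Qed.

(* The flag [q] appends a letter below all others: [simsun_word true w] says
   that [w] may be followed by a smaller letter. *)
Definition simsun_word (q : bool) (w : seq nat) :=
  forall k, ~~ has_double_descent ([seq x <- w | x < k] ++ nseq q 0).

(** The letters of [v] enter the restrictions before those of [u]: up to [c] nothing of [u] is
    visible, and from [c] on [v] is complete. Once visible, [u] is followed by the smaller [b],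
    whence its flag [true]. If [q] holds, [q <= b] puts the marker 0 below [b]. *)
Lemma simsun_word_split (q : bool) b c (u v : seq nat) :
    q <= b -> b < c -> all (fun x => c <= x) u -> all (fun x => b < x < c) v ->
  simsun_word q (u ++ b :: v) <->
  simsun_word q v /\ (u = [::] \/ simsun_word true u /\ ~~ (q && (v == [::]))).
Proof.
move=> qb bc cu bvc; have bu : all (fun x => b < x) u.
  by apply: sub_all cu => x; lia.
have u0 : all (fun x => 0 < x) u by apply: sub_all cu => x; lia.
have sub_k (a : pred nat) k : all a u -> all a [seq x <- u | x < k].
  by rewrite all_filter; apply: sub_all => x /= ->; rewrite implybT.
have u_small k : k <= c -> [seq x <- u | x < k] = [::].
  move=> kc; apply/eqP; rewrite -[_ == _]negbK -has_filter -all_predC.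
  by apply: sub_all cu => x /=; lia.
have v_large k : c <= k -> [seq x <- v | x < k] = v.
  by move=> ck; apply/all_filterP; apply: sub_all bvc => x; lia.
split=> [uvP | [vP uP] k].
  split=> [k|].
    apply: contra (uvP k) => vk.
    by rewrite -cat_rcons filter_cat -catA has_double_descent_catr.
  have [->|u_neq0] := eqVneq u [::]; [by left | right].
  split=> [k|].
    have [kc|ck] := leqP k c; first by rewrite u_small // has_double_descent_short.
    apply: contra (uvP k); rewrite cats1.
    (* The marker after [u] is exchanged for [b], which does follow [u] in the word. *)
    rewrite (@has_double_descent_rcons_low _ 0 b) ?sub_k // => uk.
    by rewrite filter_cat /= (ltn_trans bc ck) -cat_rcons -!catA has_double_descent_catl.
  apply/negP => /andP[q1 /eqP v0]; move: uvP cu bu u_neq0.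
  (* The threshold [x.+1] keeps the first letter [x] of [u], so a larger letter precedes [b] and the
     marker. *)
  rewrite {}v0 {}q1 in qb *; case: u {sub_k u_small u0} => // x u /(_ x.+1).
  move=> + cu bu _; rewrite filter_cat -catA /=.
  have -> : b < x.+1 by case/andP: bu => /=; lia.
  rewrite has_double_descent_low2 //=; first by rewrite ltnSn.
  by move: bu; rewrite -/(all _ (x :: u)) /= ltnSn /= all_filter => /andP[-> ];
    apply: sub_all => y /= ->; rewrite implybT.
(* The converse treats [k] up to [b], then up to [c], then beyond [c]. *)
rewrite filter_cat /=; have [bk|kb] := ltnP b k; last first.
  by rewrite u_small ?(leq_trans kb (ltnW bc)) //; apply: vP.
(* A descent from [b] requires the marker to follow it directly. *)
have b_head : q && (v == [::]) = false ->
   b <= head b (v ++ nseq q 0).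
  by case: (v) bvc => [|x v' /= /andP[]]; [case: (q) | lia].
rewrite -catA /=; have [kc|ck] := leqP k c.
  rewrite u_small //=; have := vP k.
  have : all (fun x => b < x < c) [seq x <- v | x < k].
    by rewrite all_filter; apply: sub_all bvc => x /= ->; rewrite implybT.
  case: [seq x <- v | x < k] => [|x w] /=.
    by move=> _ _; rewrite has_double_descent_short //; case: (q).
  by case/andP=> /andP[/ltnW bx _] _ simw; rewrite has_double_descent_cons_le.
rewrite v_large; last by lia.
have {}vP : ~~ has_double_descent (v ++ nseq q 0).
  by have := vP c; rewrite v_large.
case: uP => [u_nil|[uP /negbTE qv]].
  (* If [v] is empty too, at most [b] and the marker remain, too short for a double descent. *)
  rewrite u_nil /=; case: (v =P [::]) vP => [->|/eqP/negbTE v0 simv].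
    by rewrite (@has_double_descent_short [:: b & nseq q 0]) //; case: (q).
  by rewrite has_double_descent_cons_le // b_head // v0 andbF.
rewrite has_double_descent_cat ?b_head // negb_or.
rewrite (@has_double_descent_rcons_low _ b 0) ?sub_k // -cats1 (uP k) /=.
by rewrite has_double_descent_cons_le // b_head.
Qed.

(** * 213-avoiding words *)

Fixpoint avoids213 (w : seq nat) :=
  if w is x :: w then pairwise (fun y z => ~~ (y < x < z)) w && avoids213 w
  else true.

Lemma avoids213P w :
  reflect (forall i j k, i < j < k -> k < size w ->
             ~~ (nth 0 w j < nth 0 w i < nth 0 w k))
          (avoids213 w).
Proof.
elim: w => [|x w IH] /=; first by constructor.
apply: (iffP andP) => [[/(pairwiseP 0) xP /IH wP] [|i] [|j] [|k] //= | xwP].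
- by move=> jk kw; apply: xP => //; rewrite inE; lia.
- by rewrite andbF.
- by move=> ijk kw; apply: wP.
split; last by apply/IH => i j k ijk kw; apply: (xwP i.+1 j.+1 k.+1).
by apply/(pairwiseP 0) => j k _ kw jk; apply: (xwP 0 j.+1 k.+1).
Qed.

Lemma avoids213_catr u v : avoids213 (u ++ v) -> avoids213 v.
Proof. by elim: u => //= x u IH /andP[_ /IH]. Qed.

Lemma avoids213_catl u v : avoids213 (u ++ v) -> avoids213 u.
Proof.
by elim: u => //= x u IH /andP[+ /IH ->]; rewrite pairwise_cat => /and3P[_ ->].
Qed.

(** Otherwise [x], [b], [y] would form the pattern. *)
Lemma avoids213_above u b v : all (fun x => b < x) u -> avoids213 (u ++ b :: v) ->
  {in u & v, forall x y, y <= x}.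
Proof.
elim: u => //= x u IH /andP[bx bu] /andP[+ /(IH bu) {}IH] x' y.
rewrite inE pairwise_cat => /and3P[_ _ /= /andP[/allP xv _]] /predU1P[->|x'u] yv;
  last exact: IH.
by have /= := xv _ yv; rewrite bx /= -leqNgt.
Qed.

(** If the 2 of a pattern lies in [u], its 3 exceeds a letter of [u], so the whole pattern lies in
    [u]. The letter [b] cannot be the 2, having nothing smaller after it. *)
Lemma avoids213_split u b v :
    all (fun x => b < x) u -> all (fun x => b < x) v ->
    {in u & v, forall x y, y <= x} ->
  avoids213 u -> avoids213 v -> avoids213 (u ++ b :: v).
Proof.
elim: u => /= [_ bv _ _ ->|x u IH /andP[bx bu] bv uv].
  rewrite andbT; elim: v bv => //= y v IH /andP[by_ bv]; rewrite IH // andbT.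
  by apply/allP => z _; lia.
case/andP=> xu avu avv; rewrite IH //; last first.
  by move=> y z yu zv; apply: uv => //; rewrite inE yu orbT.
have bvx z : z \in b :: v -> z <= x.
  by rewrite inE => /predU1P[->|zv]; [lia | apply: uv; rewrite ?inE ?eqxx].
rewrite andbT pairwise_cat xu; apply/andP; split.
  by apply/allrelP=> y z _ /bvx; lia.
apply/(pairwiseP 0) => j k _ kv _.
by rewrite (ltnNge x) (bvx (nth 0 _ k)) ?mem_nth ?andbF.
Qed.

(** * Words of trees *)

(* [q = true] gives the words counted by Q = x M: they have one letter more
   than the tree has size. *)
Fixpoint tree_word (q : bool) (b : nat) (t : mtree) : seq nat :=
  match t with
  | Leaf => nseq q b
  | Unary t => b :: tree_word q b.+1 t
  | Binary t1 t2 =>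
      tree_word true (b.+1 + (tsize t2 + q)) t1 ++ b :: tree_word q b.+1 t2
  end.

Lemma size_tree_word q b t : size (tree_word q b t) = tsize t + q.
Proof.
elim: t q b => [|t IH|t1 IH1 t2 IH2] q b /=; first by rewrite size_nseq.
  by rewrite IH.
by rewrite size_cat /= IH1 IH2; lia.
Qed.

Lemma perm_tree_word q b t : perm_eq (tree_word q b t) (iota b (tsize t + q)).
Proof.
elim: t q b => [|t IH|t1 IH1 t2 IH2] q b /=.
- by case: q.
- by rewrite perm_cons.
rewrite perm_catC cat_cons perm_cons.
rewrite -/(iota b.+1 (tsize t1 + tsize t2 + q).+1).
(* The second subword fills the interval just above [b], the first one the next interval; [true]
   counts the extra letter of the first. *)
have -> : (tsize t1 + tsize t2 + q).+1 = tsize t2 + q + (tsize t1 + true) by lia.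
by rewrite iotaD; apply: perm_cat.
Qed.

Lemma mem_tree_word q b t x :
  (x \in tree_word q b t) = (b <= x < b + (tsize t + q)).
Proof. by rewrite (perm_mem (perm_tree_word q b t)) mem_iota. Qed.

Lemma tree_word_simsun (q : bool) b t : q <= b -> simsun_word q (tree_word q b t).
Proof.
elim: t q b => [|t IH|t1 IH1 t2 IH2] q b qb /=.
- move=> k; rewrite has_double_descent_short // size_cat size_filter size_nseq.
  by have := count_size (fun x => x < k) (nseq q b); rewrite size_nseq; case: (q) => /=; lia.
- apply/(@simsun_word_split q b (b.+1 + (tsize t + q)) [::]) => //.
    by rewrite addSn ltnS leq_addr.
    by apply/allP=> x; rewrite mem_tree_word.
  by split; [apply: IH; lia | left].
(* The separator is the least letter of the first subword. *)
apply/(@simsun_word_split q b (b.+1 + (tsize t2 + q))) => //.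
- by rewrite addSn ltnS leq_addr.
- by apply/allP=> x; rewrite mem_tree_word => /andP[].
- by apply/allP=> x; rewrite mem_tree_word.
split; first by apply: IH2; lia.
right; split; first by apply: IH1; lia.
by case: (q) => //=; rewrite -size_eq0 size_tree_word addn1.
Qed.

Lemma tree_word_avoids q b t : avoids213 (tree_word q b t).
Proof.
elim: t q b => [|t IH|t1 IH1 t2 IH2] q b /=; first by case: q.
  apply: (@avoids213_split [::]) => //.
  by apply/allP=> x; rewrite mem_tree_word => /andP[].
apply: avoids213_split => //.
- by apply/allP=> x; rewrite mem_tree_word; lia.
- by apply/allP=> x; rewrite mem_tree_word; lia.
- by move=> x y; rewrite !mem_tree_word; lia.
Qed.

(** Both words are cut at the first occurrence of [b]. *)
Lemma cat_cons_inj (T : eqType) (b : T) u v u' v' :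
  b \notin u -> b \notin u' -> u ++ b :: v = u' ++ b :: v' -> u = u' /\ v = v'.
Proof.
elim: u u' => [|x u IH] [|x' u'] //=.
- by move=> _ _ [->].
- by rewrite inE negb_or => _ /andP[/eqP bx' _] [].
- by rewrite inE negb_or => /andP[/eqP bx _] _ [/esym].
rewrite !inE !negb_or => /andP[_ bu] /andP[_ bu'] [-> /IH[] // -> ->].
by [].
Qed.

(** The length singles out [Leaf]; the position of the least letter [b] separates [Unary] from
    [Binary], whose first subword is never empty. *)
Lemma tree_word_inj q b : injective (tree_word q b).
Proof.
have notin q' b' c t : b' < c -> b' \notin tree_word q' c t.
  by rewrite mem_tree_word; lia.
move=> t; elim: t q b => [|t IH|t1 IH1 t2 IH2] q b t' eq_t.
- move/(congr1 size): eq_t; rewrite !size_tree_word => /addIn.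
  by case: t'.
- case: t' eq_t => [|t'|t1' t2'] /= eq_t.
  + by move/(congr1 size): eq_t; rewrite /= size_nseq size_tree_word; lia.
  + by case: eq_t => /IH->.
  + case/(@cat_cons_inj _ b [::]): eq_t => //; first by apply: notin; lia.
    by move/(congr1 size); rewrite size_tree_word /=; lia.
- case: t' eq_t => [|t'|t1' t2'] /= eq_t.
  + by move/(congr1 size): eq_t; rewrite size_cat /= size_nseq !size_tree_word; lia.
  + case/(@cat_cons_inj _ b _ _ [::]): eq_t => //; first by apply: notin; lia.
    by move/(congr1 size); rewrite size_tree_word /=; lia.
  + have [| |eq1 /IH2 eq2] := cat_cons_inj _ _ eq_t; try by apply: notin; lia.
    (* The base of the first subword depends on [tsize t2], so the second subtrees are identified
       first. *)
    by rewrite eq2 in eq1 *; rewrite (IH1 _ _ _ eq1).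
Qed.

(** Sorting [v] and [u] separately and placing [v] first sorts the whole word, which gives the
    interval; it is then cut at [size v]. *)
Lemma perm_iota_cat (u v : seq nat) c :
    {in u & v, forall x y, y <= x} ->
    perm_eq (u ++ v) (iota c (size (u ++ v))) ->
  perm_eq v (iota c (size v)) /\ perm_eq u (iota (c + size v) (size u)).
Proof.
move=> uv uvP.
have uv_sorted : sorted leq (sort leq v ++ sort leq u).
  rewrite sorted_pairwise; last exact: leq_trans.
  rewrite pairwise_cat -!sorted_pairwise ?sort_sorted; try exact: leq_trans; try exact: leq_total.
  rewrite !andbT; apply/allrelP=> y x; rewrite !mem_sort => yv xu; exact: uv.
have : sort leq v ++ sort leq u = iota c (size v + size u).
  apply: (sorted_eq leq_trans anti_leq) => //; first exact: iota_sorted.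
  apply: perm_trans (_ : perm_eq (u ++ v) _).
    by rewrite perm_catC; apply: perm_cat; apply/permPl/perm_sort.
  by rewrite addnC -size_cat.
rewrite iotaD => /eqP; rewrite eqseq_cat; last by rewrite size_sort size_iota.
case/andP=> /eqP <- /eqP <-.
by rewrite !(perm_sym _ (sort _ _)); split; apply/permPl/perm_sort.
Qed.

(** The least letter cuts [w], and each side yields a subtree by induction on the length. A flagged
    word must be nonempty because a flagged [Leaf] already has one letter. *)
Lemma tree_word_surj (q : bool) b w :
    q <= b -> (q -> w != [::]) -> perm_eq w (iota b (size w)) ->
    avoids213 w -> simsun_word q w ->
  exists t, w = tree_word q b t.
Proof.
have [m] := ubnP (size w); elim: m => // m IH in q b w *.
move=> ltm qb qw wP; have [w0|w_neq0] := eqVneq w [::].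
  by exists Leaf; rewrite w0 /=; case: (q) qw => // /(_ isT); rewrite w0.
have bw : b \in w.
  rewrite (perm_mem wP) mem_iota leqnn /= -addn1 leq_add2l lt0n.
  by rewrite size_eq0.
case/splitPr: bw => u v in ltm qw wP w_neq0 *; move=> av sim.
have {}wP : perm_eq (u ++ v) (iota b.+1 (size (u ++ v))).
  rewrite -(perm_cons b) -/(iota b (size (u ++ v)).+1).
  have <- : size (u ++ b :: v) = (size (u ++ v)).+1 by rewrite !size_cat addnS.
  by rewrite -(permPr wP) perm_sym (perm_catCA u [:: b] v).
have /allP uvP : all (fun x => b < x) (u ++ v).
  by apply/allP=> x; rewrite (perm_mem wP) mem_iota => /andP[].
have bu : all (fun x => b < x) u by apply/allP=> x xu; rewrite uvP // mem_cat xu.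
have bv : all (fun x => b < x) v by apply/allP=> x xv; rewrite uvP // mem_cat xv orbT.
have [vP uP] := perm_iota_cat (avoids213_above bu av) wP.
(* The separator is where the interval of letters of [u] begins. *)
have /(@simsun_word_split q b (b.+1 + size v))[] := sim => //.
- by rewrite addSn ltnS leq_addr.
- by apply/allP=> x; rewrite (perm_mem uP) mem_iota => /andP[].
- by apply/allP=> x; rewrite (perm_mem vP) mem_iota.
move=> simv simu.
have avv : avoids213 v by move: av; rewrite -cat_rcons; apply: avoids213_catr.
have [/andP[q1 /eqP v0]|qv] := boolP (q && (v == [::])).
  (* Here [u] is forced to be empty, and the one-letter word is that of a flagged [Leaf]. *)
  case: simu => [u0|[_]]; last by rewrite q1 v0.
  by exists Leaf; rewrite u0 v0 q1.
have [| | |t2 def_v] := IH q b.+1 v _ _ _ vP avv simv.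
- by move: ltm; rewrite size_cat /=; lia.
- by lia.
- by move=> q1; move: qv; rewrite q1.
have [u0|u_neq0] := eqVneq u [::]; first by exists (Unary t2); rewrite u0 /= def_v.
case: simu => [/eqP/negPn/negP[] //|[simu _]].
have [| | |t1 def_u] := IH true (b.+1 + size v) u _ _ _ uP (avoids213_catl av) simu => //.
- by move: ltm; rewrite size_cat /=; lia.
by exists (Binary t1 t2); rewrite /= -(size_tree_word q b.+1) -def_v -def_u.
Qed.

(** * Permutations as words *)

Lemma word_nth n (s : 'S_n) (i : 'I_n) : nth 0 (word s) i = s i.
Proof.
by rewrite (nth_map i) ?size_enum_ord // nth_ord_enum.
Qed.

Lemma size_word n (s : 'S_n) : size (word s) = n.
Proof. by rewrite size_map size_enum_ord. Qed.

Lemma word_inj n : injective (@word n).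
Proof.
move=> s s' eq_s; apply/permP=> i; apply/val_inj.
by rewrite /= -!word_nth eq_s.
Qed.

Lemma perm_word n (s : 'S_n) : perm_eq (word s) (iota 0 n).
Proof.
rewrite /word -val_enum_ord (map_comp val s); apply/perm_map/uniq_perm.
- by rewrite map_inj_uniq ?enum_uniq //; apply: perm_inj.
- exact: enum_uniq.
move=> i; rewrite mem_enum; apply/mapP; exists (s^-1%g i); first by rewrite mem_enum.
by rewrite permKV.
Qed.

Lemma word_surj n w : perm_eq w (iota 0 n) -> exists s : 'S_n, word s = w.
Proof.
move=> wP; have szw : size w = n by rewrite (perm_size wP) size_iota.
have ltw (i : 'I_n) : nth 0 w i < n.
  by have: nth 0 w i \in w by [rewrite mem_nth ?szw]; rewrite (perm_mem wP) mem_iota.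
have f_inj : injective (fun i => Ordinal (ltw i)).
  move=> i j [/eqP]; rewrite nth_uniq ?szw ?(perm_uniq wP) ?iota_uniq // => /eqP ij.
  exact: val_inj.
exists (perm f_inj); apply: (@eq_from_nth _ 0); rewrite size_word ?szw // => i lti.
by rewrite (word_nth _ (Ordinal lti)) permE.
Qed.

Lemma simsunE n (s : 'S_n) : simsun s <-> simsun_word false (word s).
Proof.
split=> [/forallP sim k|sim]; last first.
  by apply/forallP=> k; have := sim k; rewrite cats0.
rewrite cats0; have [kn|nk] := leqP k n; first exact: (sim (Ordinal (kn : k < n.+1))).
have := sim ord_max; congr (~~ has_double_descent _).
apply: eq_in_filter => x; rewrite (perm_mem (perm_word s)) mem_iota /=; lia.
Qed.

Lemma avoids_patternE n (s : 'S_n) : avoids_pattern perm213 s = avoids213 (word s).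
Proof.
have p213 (j : 'I_3) : perm213 j = nth 0 [:: 1; 0; 2] j :> nat.
  by rewrite -word_perm213 word_nth.
apply/idP/avoids213P => [av i j k /andP[ij jk]|av].
  rewrite size_word => kn; have jn := ltn_trans jk kn; have in_ := ltn_trans ij jn.
  rewrite (word_nth s (Ordinal in_)) (word_nth s (Ordinal jn)) (word_nth s (Ordinal kn)).
  apply: contra av => /andP[ji ik]; apply/existsP.
  (* The three positions form the embedding; the default of [nth] is never reached. *)
  exists [ffun l : 'I_3 => nth (Ordinal in_) [:: Ordinal in_; Ordinal jn; Ordinal kn] l].
  by apply/andP; split; apply/forallP=> -[[|[|[|]]] // ?]; apply/forallP=> -[[|[|[|]]] // ?];
    rewrite !ffunE ?p213 //=; lia.
apply/negP=> /existsP[f /andP[/forallP f_incr /forallP f_pat]].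
pose o l (lt_l : l < 3) := Ordinal lt_l.
have incr (i j : 'I_3) : i < j -> f i < f j by have /forallP/(_ j)/implyP := f_incr i.
have pat i j : (s (f i) < s (f j)) = (perm213 i < perm213 j).
  by have /forallP/(_ j)/eqP := f_pat i.
have := av (f (o 0 isT)) (f (o 1 isT)) (f (o 2 isT)).
by rewrite !incr // size_word ltn_ord !word_nth !pat !p213 => /(_ isT isT).
Qed.

Theorem theorem3p1 (n : nat) (n_ge1 : 1 <= n) :
  #|RS n perm213| = motzkin n.
Proof.
(* A permutation and a path are related when they come from the same tree; [r] and its converse give
   the two inequalities. *)
pose r (s : 'S_n) (p : n.-tuple motzkin_step) :=
  exists t, word s = tree_word false 0 t /\ val p = tree_path t.
apply/eqP; rewrite eqn_leq; apply/andP; split.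
  apply: (@leq_card_rel _ _ _ _ r) => [s|s s' p [t [def_s def_p]] [t' [def_s' def_p']]].
    rewrite inE avoids_patternE => /andP[/simsunE sim av].
    have [| | |t def_s] := @tree_word_surj false 0 (word s) _ _ _ av sim => //.
      by rewrite size_word perm_word.
    have szt : size (tree_path t) == n.
      by rewrite size_tree_path -[tsize t]addn0 -(size_tree_word false 0) -def_s size_word.
    exists (Tuple szt); last by exists t.
    rewrite inE motzkin_pathE; last exact/eqP.
    by have := path_from_cat 0 t [::]; rewrite cats0 => /= ->.
  have /tree_path_inj tt' : tree_path t = tree_path t' by rewrite -def_p.
  by apply: word_inj; rewrite def_s def_s' tt'.
apply: (@leq_card_rel _ _ _ _ (fun p s => r s p)) => [p|p p' s [t [def_s def_p]] [t' [def_s' def_p']]].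
  rewrite inE motzkin_pathE ?size_tuple // => /path_from0P[t def_p].
  have szt : tsize t + false = n.
    by rewrite addn0 -size_tree_path -def_p size_tuple.
  have [s def_s] : exists s : 'S_n, word s = tree_word false 0 t.
    by apply: word_surj; rewrite -szt perm_tree_word.
  exists s; last by exists t.
  rewrite inE avoids_patternE def_s tree_word_avoids andbT.
  by apply/simsunE; rewrite def_s; apply: tree_word_simsun.
have /tree_word_inj tt' : tree_word false 0 t = tree_word false 0 t' by rewrite -def_s.
by apply: val_inj; rewrite def_p def_p' tt'.
Qed.
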